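(* Let $\Omega\subseteq\mathbb{R}^2$ be an open set and let $f:\Omega\to\mathbb{R}$ be a $C^1$ function such that $(0,0)\in\Omega$, $f(0,0)=0$, and $$(x,y)\in\Omega\quad\Longrightarrow\quad (y,x)\in\Omega,\quad f(y,x)=f(x,y).$$ Let $\Gamma$ be the connected component of $f^{-1}(0)=\{(x,y)\in\Omega: f(x,y)=0\}$ that contains the origin. Suppose that $\partial_2 f(x,y)\neq 0$ for all $(x,y)\in\Gamma$. Then $\Gamma$ is the graph of a smooth involution $h$. Moreover, all smooth involutions can be obtained this way: for every smooth involution $h:J\to J$ on an open interval $J\subseteq\mathbb{R}$ there exist an open set $\Omega\subseteq\mathbb{R}^2$ and a $C^1$ function $f:\Omega\to\mathbb{R}$ satisfying all the hypotheses above such that the corresponding $\Gamma$ is the graph of $h$.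
   Context: An involution on an open interval $J\subseteq\mathbb{R}$ is a continuous function $h$ of $J$ onto itself such that $h^{-1}=h$ (i.e. $h(h(x))=x$ for all $x\in J$), $0\in J$, $h(0)=0$, and $h\neq \mathrm{id}_J$ (the identity function of $J$). It is called a smooth involution if in addition $h\in C^1(J)$. The notation $\partial_2 f$ denotes the partial derivative of $f$ with respect to its second variable. The graph of $h:J\to J$ is $\{(x,h(x)):x\in J\}\subseteq\mathbb{R}^2$. *)

(* Defs.v *)
From mathcomp Require Import all_boot all_order all_algebra.
From mathcomp Require Import all_classical all_reals all_analysis.

Set Implicit Arguments.
Unset Strict Implicit.
Unset Printing Implicit Defensive.

Import Order.TTheory GRing.Theory Num.Theory.
Import numFieldNormedType.Exports.

Local Open Scope classical_set_scope.
Local Open Scope ring_scope.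

(* Functions on a subset are represented by total functions, all conditions
   being imposed on the subset only. Every notion of differentiability below is
   used on open sets, where it does not depend on the values taken outside. *)

Definition partial1 (R : realType) (f : R * R -> R) (p : R * R) : R :=
  'D_(1, 0) f p.

Definition partial2 (R : realType) (f : R * R -> R) (p : R * R) : R :=
  'D_(0, 1) f p.

Definition C1_on (R : realType) (J : set R) (h : R -> R) : Prop :=
  (forall x, J x -> derivable h x 1) /\ {within J, continuous (derive1 h)}.

Definition C1_on2 (R : realType) (Omega : set (R * R)) (f : R * R -> R) : Prop :=
  [/\ forall p, Omega p -> derivable f p (1, 0) /\ derivable f p (0, 1),
      {within Omega, continuous (partial1 f)} &
      {within Omega, continuous (partial2 f)}].

Definition open_interval (R : realType) (J : set R) : Prop :=
  open J /\ is_interval J.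

Record involution_on (R : realType) (J : set R) (h : R -> R) : Prop :=
  InvolutionOn {
    involution_continuous : {within J, continuous h} ;
    involution_onto : h @` J = J ;
    involution_invol : forall x, J x -> h (h x) = x ;
    involution_dom0 : J 0 ;
    involution_at0 : h 0 = 0 ;
    involution_neq_id : exists2 x, J x & h x <> x }.

Definition smooth_involution_on (R : realType) (J : set R) (h : R -> R) : Prop :=
  involution_on J h /\ C1_on J h.

Definition graph_on (R : realType) (J : set R) (h : R -> R) : set (R * R) :=
  [set p | J p.1 /\ p.2 = h p.1].

Definition zero_set (R : realType) (Omega : set (R * R)) (f : R * R -> R) :
    set (R * R) :=
  [set p | Omega p /\ f p = 0].

Definition zero_component (R : realType) (Omega : set (R * R))
    (f : R * R -> R) : set (R * R) :=
  connected_component (zero_set Omega f) (0, 0).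

Record symmetric_C1_data (R : realType) (Omega : set (R * R))
    (f : R * R -> R) : Prop := SymmetricC1Data {
  data_open : open Omega ;
  data_C1 : C1_on2 Omega f ;
  data_origin : Omega (0, 0) ;
  data_f0 : f (0, 0) = 0 ;
  data_sym : forall x y, Omega (x, y) -> Omega (y, x) /\ f (y, x) = f (x, y) ;
  data_partial2 : forall p, zero_component Omega f p -> partial2 f p <> 0 }.

(* Main.v *)
Require Import Defs.
From mathcomp Require Import all_boot all_order all_algebra.
From mathcomp Require Import all_classical all_reals all_analysis.
From mathcomp Require Import ring lra.

(** Near a point where the second partial derivative of [f] does not vanish,
    the zero set of [f] is the graph of a continuous function over a small
    interval ([implicit_local_graph]); this is the implicit function theorem in
    the plane, and only the mean value theorem and the intermediate value
    theorem along horizontal and vertical segments are needed for it.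

    Local graphs do not yet exclude that a vertical line meets the component
    [Gamma] of the origin twice. For this one follows the branches of the zero
    set through the origin, that is, the continuous functions on open intervals
    around 0 that vanish at 0 and have their graph in the zero set. Two
    branches agree where both are defined, since the set where they agree is
    open (by local uniqueness) and closed in an interval. So all branches glue
    to one function [h] on an open interval [J]. Its graph is open in [Gamma]
    by local uniqueness; it is also closed in [Gamma], because at a limit point
    of the graph the local graph prolongs some branch up to that point. As
    [Gamma] is connected, it equals the graph of [h] ([component_graph]).

    Implicit differentiation gives h' = - partial1 f / partial2 f along the
    graph ([implicit_derive]), hence [h] is of class C1. The reflection in the
    diagonal preserves [Gamma], which says that h (h x) = x, and symmetry of
    [f] gives h' 0 = -1, so that [h] is not the identity.

    Conversely, let [h] be a smooth involution of [J]. It is decreasing, because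
    an increasing involution is the identity. Then t - h t is strictly
    increasing with derivative at least 1, and f (x, y) = (x - h x) + (y - h y)
    on the square of [J] is symmetric, has partial2 f >= 1, and vanishes
    exactly on the graph of [h], which is connected. *)

Set Implicit Arguments.
Unset Strict Implicit.
Unset Printing Implicit Defensive.
Import Order.TTheory GRing.Theory Num.Theory.
Import numFieldNormedType.Exports.

Local Open Scope classical_set_scope.
Local Open Scope ring_scope.

(** * Connectedness and intervals *)

(** The two local conditions make [A `&` P] and [A `&` ~` P] separated. This
    form lets clopen arguments be carried out point by point, with
    neighbourhoods in the ambient space. *)
Lemma connected_locally_decided (T : topologicalType) (A P : set T) (x0 : T) :
  connected A -> A x0 -> P x0 ->
  (forall x, A x -> P x -> \forall y \near x, A y -> P y) ->
  (forall x, A x -> ~ P x -> \forall y \near x, A y -> ~ P y) ->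
  A `<=` P.
Proof.
move=> cA Ax0 Px0 Pnear nPnear.
have sep : separated (A `&` P) (A `&` ~` P).
  split; apply/seteqP; split=> // x [].
  - move=> clx [Ax nPx].
    by have [y [[Ay Py] /(_ Ay)]] := clx _ (nPnear _ Ax nPx).
  - move=> [Ax Px] clx.
    by have [y [[Ay nPy] /(_ Ay)]] := clx _ (Pnear _ Ax Px).
have cover : A `<=` A `&` P `|` A `&` ~` P.
  by move=> x Ax; have [Px|nPx] := pselect (P x); [left|right].
have [AP x /AP[]//|AnP] := connected_subset sep cover cA.
by have [] := AnP _ Ax0.
Qed.

Lemma continuous_near_eq (T U : topologicalType) (f g : T -> U) (x : T) :
  {near x, f =1 g} -> {for x, continuous f} -> {for x, continuous g}.
Proof.
move=> fg cf; rewrite /prop_for /continuous_at -(nbhs_singleton fg).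
by apply: cvg_trans cf; exact: near_eq_cvg.
Qed.

Section Intervals.
Variable R : realType.
Implicit Types (p : R * R) (I J : set R) (u : R -> R).

Lemma is_interval_setI I J : is_interval I -> is_interval J ->
  is_interval (I `&` J).
Proof.
move=> iI iJ x y [Ix Jx] [Iy Jy] z xzy.
by split; [exact: (iI x y)|exact: (iJ x y)].
Qed.

Lemma is_interval_setU I J x0 : is_interval I -> is_interval J ->
  I x0 -> J x0 -> is_interval (I `|` J).
Proof.
move=> iI iJ Ix Jx; apply/connected_intervalP/connectedU; first by exists x0.
- exact/connected_intervalP.
- exact/connected_intervalP.
Qed.

Lemma is_interval_ball (a d : R) : is_interval (ball a d).
Proof.
move=> x y; rewrite -!ball_normE /= => ax ay z /andP[xz zy].
move: ax ay; rewrite !ltr_distlC => /andP[ax xa] /andP[ay ya].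
by rewrite (lt_le_trans ax xz) (le_lt_trans zy ya).
Qed.

Lemma connected_graph I u : is_interval I ->
  (forall x, I x -> {for x, continuous u}) -> connected (graph_on I u).
Proof.
move=> iI cu.
have -> : graph_on I u = (fun x => (x, u x)) @` I.
  apply/seteqP; split=> [[x y] [/= Ix ->]|_ [x Ix <-]]; first by exists x.
  by [].
apply: connected_continuous_connected; first exact/connected_intervalP.
apply: continuous_in_subspaceT => x /[1!inE] Ix.
by apply: (@cvg_pair _ _ _ (nbhs x) (nbhs x) (nbhs (u x)));
  [exact: cvg_id|exact: cu].
Qed.

Lemma near_prod p (P Q : set R) : nbhs p.1 P -> nbhs p.2 Q ->
  \forall q \near p, P q.1 /\ Q q.2.
Proof. by move=> nP nQ; exists (P, Q). Qed.

End Intervals.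

(** * Gluing local graphs *)

Section Branches.
Variable R : realType.
Implicit Types (Z : set (R * R)) (p : R * R) (I J : set R) (u v g h : R -> R).

(** The height [r] of the box is bounded because [Z] may have further points,
    away from [p], over the same abscissas. *)
Definition local_graph Z p := exists (d r : R) g,
  [/\ 0 < d, 0 < r, g p.1 = p.2,
      forall x, ball p.1 d x -> ball p.2 r (g x) /\ {for x, continuous g} &
      forall x y, ball p.1 d x -> ball p.2 r y -> (Z (x, y) <-> y = g x)].

Definition branch Z I u :=
  [/\ open_interval I, I 0, u 0 = 0, forall x, I x -> {for x, continuous u} &
      forall x, I x -> Z (x, u x)].

(** The agreement set is closed in [I] by continuity. It is open because a
    local graph around a common point contains both graphs near that point. *)
Lemma agree_of_local_graph Z I u v (x0 : R) : is_interval I ->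
  (forall x, I x -> {for x, continuous u}) ->
  (forall x, I x -> {for x, continuous v}) ->
  (forall x, I x -> Z (x, u x)) -> (forall x, I x -> Z (x, v x)) ->
  (forall x, I x -> local_graph Z (x, u x)) ->
  I x0 -> u x0 = v x0 -> forall x, I x -> u x = v x.
Proof.
move=> itvI cu cv Zu Zv lg Ix0 uv0.
apply: (@connected_locally_decided R I (fun x => u x = v x) x0) => //.
- exact/connected_intervalP.
- move=> x Ix uv; have [d [r [g [d0 r0 /= gx gP gZ]]]] := lg _ Ix.
  near=> y => Iy.
  have xdy : ball x d y by near: y; apply: nbhsx_ballx.
  have -> : u y = g y.
    apply/(gZ _ _ xdy) => //; last exact: Zu.
    by near: y; apply: (cu _ Ix); apply: nbhsx_ballx.
  apply/esym/(gZ _ _ xdy) => //; last exact: Zv.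
  by near: y; rewrite uv; apply: (cv _ Ix); apply: nbhsx_ballx.
- move=> x Ix /eqP uv; near=> y => _; apply/eqP; rewrite -subr_eq0; near: y.
  apply: (cvgr_neq0 (u x - v x)); last by rewrite subr_eq0.
  by apply: cvgB; [exact: cu|exact: cv].
Unshelve. all: by end_near. Qed.

Section Component.
Variable Z : set (R * R).
Let Gamma := connected_component Z (0, 0).
Hypothesis lgZ : forall p, Gamma p -> local_graph Z p.

Lemma branch_component I u : branch Z I u -> graph_on I u `<=` Gamma.
Proof.
move=> [[oI iI] I0 u0 cu Zu]; apply: connected_component_max.
- by split=> //=.
- by move=> [x y] /= [/= Ix ->]; exact: Zu.
- exact: connected_graph.
Qed.

(** The second solution is only required to meet the branch somewhere, not to
    pass through the origin: this covers both two branches and a branch against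
    a local graph. *)
Lemma branch_agree I u J v (x : R) : branch Z I u -> is_interval J ->
  (forall t, J t -> {for t, continuous v}) -> (forall t, J t -> Z (t, v t)) ->
  I x -> J x -> u x = v x -> forall t, I t -> J t -> u t = v t.
Proof.
move=> bu iJ cv Zv Ix Jx uv t It Jt; have [[_ iI] I0 u0 cu Zu] := bu.
apply: (@agree_of_local_graph Z (I `&` J) u v x) => //.
- exact: is_interval_setI.
- by move=> y [Iy _]; exact: cu.
- by move=> y [_ Jy]; exact: cv.
- by move=> y [Iy _]; exact: Zu.
- by move=> y [_ Jy]; exact: Zv.
- by move=> y [Iy _]; apply/lgZ/(branch_component bu); split.
Qed.

Lemma branch_extend I u J v (x : R) : branch Z I u -> open_interval J ->
  (forall t, J t -> {for t, continuous v}) -> (forall t, J t -> Z (t, v t)) ->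
  I x -> J x -> u x = v x ->
  branch Z (I `|` J) (fun t => if t \in I then u t else v t).
Proof.
move=> bu [oJ iJ] cv Zv Ix Jx uv; have [[oI iI] I0 u0 cu Zu] := bu.
have wE t : J t -> (if t \in I then u t else v t) = v t.
  move=> Jt; case: ifPn => // /set_mem It.
  exact: (branch_agree bu iJ cv Zv Ix Jx uv).
split.
- by split; [exact: openU|exact: is_interval_setU iI iJ Ix Jx].
- by left.
- by rewrite mem_set.
- move=> y [Iy|Jy].
  + apply: continuous_near_eq (cu _ Iy); near=> t.
    by rewrite /= mem_set//; near: t; exact: open_nbhs_nbhs.
  + apply: continuous_near_eq (cv _ Jy); near=> t.
    by rewrite /= wE//; near: t; exact: open_nbhs_nbhs.
- move=> y [Iy|Jy]; first by rewrite mem_set//; exact: Zu.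
  by rewrite wE//; exact: Zv.
Unshelve. all: by end_near. Qed.

(** The points lying on some branch form a clopen subset [G] of the component.
    At a point of [G], the local graph forces nearby points of the component
    onto the same branch. At a point outside [G], no nearby point of the
    component lies in [G], since otherwise the local graph would prolong a
    branch up to the point. *)
Lemma component_graph : Z (0, 0) -> exists (J : set R) (h : R -> R),
  [/\ open_interval J, J 0, h 0 = 0, forall x, J x -> {for x, continuous h} &
      Gamma = graph_on J h].
Proof.
move=> Z0.
have G0 : Gamma (0, 0) by exact: connected_component_refl.
pose G : set (R * R) := [set p | exists I u, branch Z I u /\ graph_on I u p].
have G00 : G (0, 0).
  have [d [r [g [d0 r0 /= g0 gP gZ]]]] := lgZ G0.
  exists (ball 0 d), g; split; last first.
    by split=> //=; exact: ballxx.
  split=> //.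
  - by split; [exact: ball_open|exact: is_interval_ball].
  - exact: ballxx.
  - by move=> x /gP[].
  - by move=> x bx; apply/gZ => //; exact: (gP _ bx).1.
have GG : Gamma `<=` G.
  apply: (@connected_locally_decided _ Gamma G (0, 0)) => //.
  - exact: component_connected.
  - move=> p Gp [I [u [bu [Ip up]]]].
    have [[oI iI] I0 u0 cu Zu] := bu.
    have [d [r [g [d0 r0 /= gp gP gZ]]]] := lgZ Gp.
    have nx : \forall x \near p.1, ball p.1 d x /\ I x /\ ball p.2 r (u x).
      near=> x; split; [|split]; near: x.
      + exact: nbhsx_ballx.
      + exact: open_nbhs_nbhs.
      + by rewrite up; apply: (cu _ Ip); apply: nbhsx_ballx.
    apply: filterS (near_prod nx (nbhsx_ballx p.2 r r0)).
    move=> -[x y] /= [[bx [Ix bux]] bry] /connected_component_sub Zxy.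
    exists I, u; split => //; split => //=.
    have /(_ Zxy)-> := (gZ _ _ bx bry).1.
    by have /(_ (Zu _ Ix))-> := (gZ _ _ bx bux).1.
  - move=> p Gp nGp.
    have [d [r [g [d0 r0 /= gp gP gZ]]]] := lgZ Gp.
    apply: filterS (near_prod (nbhsx_ballx p.1 d d0) (nbhsx_ballx p.2 r r0)).
    move=> -[x y] /= [bx bry] /connected_component_sub Zxy.
    move=> [I [u [bu [/= Ix yu]]]]; apply: nGp.
    have ug : u x = g x.
      by rewrite -yu; exact: (gZ _ _ bx bry).1.
    have oiB : open_interval (ball p.1 d : set R).
      by split; [exact: ball_open|exact: is_interval_ball].
    have cg t : ball p.1 d t -> {for t, continuous g} by move=> /gP[].
    have Zg t : ball p.1 d t -> Z (t, g t).
      by move=> bt; apply/gZ => //; exact: (gP _ bt).1.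
    exists (I `|` ball p.1 d), (fun t => if t \in I then u t else g t).
    split; first exact: branch_extend bu oiB cg Zg Ix bx ug.
    split; first by right; exact: ballxx.
    case: ifPn => [/set_mem Ip|]; last by rewrite gp.
    rewrite -gp; apply/esym.
    by apply: (branch_agree bu oiB.2 cg Zg Ix bx ug) => //; exact: ballxx.
pose J : set R := \bigcup_(I in [set I | exists u, branch Z I u]) I.
pose h x : R := xget 0 [set y | G (x, y)].
have hE I u x : branch Z I u -> I x -> h x = u x.
  move=> bu Ix; rewrite /h; case: xgetP => [y _ [I' [u' [bu' [/= Ix' ->]]]]|].
    have [[_ iI] I0 u0 cu Zu] := bu; have [_ I0' u0' _ _] := bu'.
    by apply: (branch_agree bu' iI cu Zu I0' I0) => //; rewrite u0' u0.
  by move=> nex; exfalso; apply: (nex (u x)); exists I, u.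
have J0 : J 0.
  have [I [u [bu [/= I0 _]]]] := G00.
  by exists I => //; exists u.
exists J, h; split => //.
- split; first by apply: bigcup_open => I [u [[]]].
  apply/connected_intervalP/bigcup_connected.
  + by exists 0 => I [u []].
  + by move=> I [u [[_ iI] _ _ _ _]]; exact/connected_intervalP.
- have [I [u [bu [/= I0 _]]]] := G00.
  by rewrite (hE _ _ _ bu I0); have [_ _ ->] := bu.
- move=> x [I [u bu] Ix]; have [[oI iI] I0 u0 cu Zu] := bu.
  apply: continuous_near_eq (cu _ Ix); near=> t.
  rewrite (hE _ _ _ bu) //; near: t; exact: open_nbhs_nbhs.
- apply/seteqP; split=> [p /GG[I [u [bu [Ip up]]]]|p [[I [u bu] Ip] hp]].
    split; first by exists I => //; exists u.
    by rewrite (hE _ _ _ bu Ip).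
  apply: (branch_component bu); split=> //.
  by rewrite hp (hE _ _ _ bu Ip).
Unshelve. all: by end_near. Qed.

End Component.
End Branches.

(** * Partial derivatives as derivatives of slices *)

Section Slices.
Variable R : realType.
Implicit Types (f : R * R -> R) (x y : R).

Lemma growth_slice1 f x y :
  (fun t : R => t^-1 *: ((f \o shift (x, y)) (t *: (1, 0)) - f (x, y))) =
  (fun t : R => t^-1 *: (((fun s => f (s, y)) \o shift x) (t *: 1) - f (x, y))).
Proof.
apply/funext => t /=; congr (_ *: (f (_, _) - _)).
by rewrite /= scaler0 add0r.
Qed.

Lemma growth_slice2 f x y :
  (fun t : R => t^-1 *: ((f \o shift (x, y)) (t *: (0, 1)) - f (x, y))) =
  (fun t : R => t^-1 *: (((fun s => f (x, s)) \o shift y) (t *: 1) - f (x, y))).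
Proof.
apply/funext => t /=; congr (_ *: (f (_, _) - _)).
by rewrite /= scaler0 add0r.
Qed.

Lemma derivable_slice1 f x y :
  derivable f (x, y) (1, 0) <-> derivable (fun s => f (s, y)) x 1.
Proof. by rewrite /derivable growth_slice1. Qed.

Lemma partial1_slice f x y : partial1 f (x, y) = 'D_1 (fun s => f (s, y)) x.
Proof. by rewrite /partial1 /derive growth_slice1. Qed.

Lemma derivable_slice2 f x y :
  derivable f (x, y) (0, 1) <-> derivable (fun s => f (x, s)) y 1.
Proof. by rewrite /derivable growth_slice2. Qed.

Lemma partial2_slice f x y : partial2 f (x, y) = 'D_1 (fun s => f (x, s)) y.
Proof. by rewrite /partial2 /derive growth_slice2. Qed.

(** The mean value theorem between two points of a ball, in whichever order they
    come; the intermediate point is only located in the ball. *)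
Lemma MVT_ball (F dF : R -> R) (a r x y : R) :
  (forall z, ball a r z -> is_derive z 1 F (dF z)) ->
  ball a r x -> ball a r y ->
  exists2 c, ball a r c & F x - F y = dF c * (x - y).
Proof.
move=> dFP; wlog yx : x y / y <= x => [hw bx bw|bx bw].
  have [|/ltW] := leP y x; first by move/hw; exact.
  move=> /hw /(_ bw bx) [c bc e]; exists c => //.
  by rewrite -opprB e -mulrN opprB.
have bsub z : z \in `[y, x] -> ball a r z.
  by rewrite in_itv /= => yzx; exact: (is_interval_ball bw bx).
have [||c cyx e] := @MVT_segment R F dF y x yx.
- by move=> z /subset_itv_oo_cc /bsub; exact: dFP.
- by apply: derivable_within_continuous => z /bsub /dFP [].
- by exists c => //; exact: bsub.
Qed.

End Slices.

(** * The implicit function theorem in the plane *)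

Section ImplicitFunction.
Variable R : realType.
Variables (Omega : set (R * R)) (f : R * R -> R).
Hypotheses (oO : open Omega) (C1f : C1_on2 Omega f).
Implicit Types (p q : R * R) (x y : R).

Lemma is_derive_partial1 x y : Omega (x, y) ->
  is_derive x 1 (fun s => f (s, y)) (partial1 f (x, y)).
Proof.
have [df _ _] := C1f; move=> /df[d1 _].
by apply: DeriveDef; [exact/derivable_slice1|rewrite partial1_slice].
Qed.

Lemma is_derive_partial2 x y : Omega (x, y) ->
  is_derive y 1 (fun s => f (x, s)) (partial2 f (x, y)).
Proof.
have [df _ _] := C1f; move=> /df[_ d2].
by apply: DeriveDef; [exact/derivable_slice2|rewrite partial2_slice].
Qed.

Lemma continuous_partial1 p : Omega p -> {for p, continuous (partial1 f)}.
Proof.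
have [_ + _] := C1f; rewrite continuous_open_subspace// => c Op.
by apply: c; rewrite inE.
Qed.

Lemma continuous_partial2 p : Omega p -> {for p, continuous (partial2 f)}.
Proof.
have [_ _] := C1f; rewrite continuous_open_subspace// => c Op.
by apply: c; rewrite inE.
Qed.

Lemma increment_vertical p (r x y y' : R) : ball p r `<=` Omega ->
  ball p r (x, y) -> ball p r (x, y') ->
  exists2 c, ball p r (x, c) &
    f (x, y) - f (x, y') = partial2 f (x, c) * (y - y').
Proof.
move=> pO [/= bx byr] [/= _ byr'].
have [|c bc e] := @MVT_ball R (fun s => f (x, s))
  (fun s => partial2 f (x, s)) p.2 r y y' _ byr byr'.
  by move=> z bz; apply: is_derive_partial2; apply: pO.
by exists c.
Qed.

Lemma increment_horizontal p (r x x' y : R) : ball p r `<=` Omega ->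
  ball p r (x, y) -> ball p r (x', y) ->
  exists2 c, ball p r (c, y) &
    f (x, y) - f (x', y) = partial1 f (c, y) * (x - x').
Proof.
move=> pO [/= bx byr] [/= bx' _].
have [|c bc e] := @MVT_ball R (fun s => f (s, y))
  (fun s => partial1 f (s, y)) p.1 r x x' _ bx bx'.
  by move=> z bz; apply: is_derive_partial1; apply: pO.
by exists c.
Qed.

(** The second partial derivative keeps its sign on the box, so just above and
    below the zero [q] the function [f] takes values of opposite signs. By
    continuity along horizontal lines these signs persist over nearby abscissas
    [x], and the intermediate value theorem gives a zero over [x]. *)
Lemma near_zero_above p q (r e : R) :
  ball p r `<=` [set q | Omega q /\ 0 < partial2 f p * partial2 f q] ->
  ball p r q -> f q = 0 -> 0 < e ->
  \forall x \near q.1, exists y, [/\ ball p.2 r y, ball q.2 e y & f (x, y) = 0].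
Proof.
move: q => [x0 y0]; set c := partial2 f p.
move=> pO [/= bx0 by0] f0 e0.
have pO' : ball p r `<=` Omega by move=> q /pO[].
have [s [s0 se sr]] : exists s : R,
    [/\ 0 < s, s < e & forall y, `|y - y0| <= s -> ball p.2 r y].
  have : nbhs y0 (ball p.2 r).
    by apply: open_nbhs_nbhs; split => //; exact: ball_open.
  move=> /nbhs_ballP[s' /= s'0 ss'].
  have m0 : 0 < Num.min s' e by rewrite lt_min s'0.
  have h2 : Num.min s' e / 2 < Num.min s' e.
    by rewrite ltr_pdivrMr// mulr2n mulrDr mulr1 ltrDl.
  exists (Num.min s' e / 2); split; first by rewrite divr_gt0.
    by rewrite (lt_le_trans h2)// ge_min lexx orbT.
  move=> y yy0; apply: ss'; rewrite -ball_normE /= distrC.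
  by rewrite (le_lt_trans yy0)// (lt_le_trans h2)// ge_min lexx.
have bt t : `|t| <= s -> ball p r (x0, y0 + t).
  by move=> ts; split => //=; apply: sr; rewrite addrAC subrr add0r.
have z0 : `|0 : R| <= s by rewrite normr0 ltW.
(* On the vertical line through [q], c * f has the sign of the height above
   [q], where [c] normalises the sign of the second partial derivative. *)
have sgn t : `|t| <= s -> t != 0 -> 0 < c * f (x0, y0 + t) * t.
  move=> ts t0.
  have [d /pO [_ bd]] := increment_vertical pO' (bt t ts) (bt 0 z0).
  rewrite addr0 f0 subr0 => ->.
  rewrite addrAC subrr add0r.
  by rewrite mulrA -mulrA mulr_gt0// -expr2 exprn_even_gt0.
have ct t : `|t| <= s -> {for x0, continuous (fun x => c * f (x, y0 + t))}.
  move=> ts; apply: cvgM; first exact: cvg_cst.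
  have /is_derive_partial1[dt _] := pO' _ (bt _ ts).
  by apply/differentiable_continuous/derivable1_diffP.
have sp : `|s| <= s by rewrite gtr0_norm.
have sn : `|- s| <= s by rewrite normrN.
near=> x.
have bx : ball p.1 r x.
  by near: x; apply: open_nbhs_nbhs; split => //; exact: ball_open.
have fp : 0 < c * f (x, y0 + s).
  near: x; apply: (cvgr_gt (c * f (x0, y0 + s))); first exact: ct.
  by have := sgn s sp (lt0r_neq0 s0); rewrite pmulr_lgt0.
have fn : c * f (x, y0 - s) < 0.
  near: x; apply: (cvgr_lt (c * f (x0, y0 - s))); first exact: ct.
  have := sgn (- s) sn; rewrite oppr_eq0 => /(_ (lt0r_neq0 s0)).
  by rewrite mulrN oppr_gt0 pmulr_llt0.
have ys z : z \in `[y0 - s, y0 + s] -> `|z - y0| <= s.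
  by rewrite in_itv /= ler_distl.
have [|||z /ys zs cf0] := @IVT R (fun y => c * f (x, y)) (y0 - s) (y0 + s) 0.
- by rewrite lerBlDr -addrA lerDl addr_ge0// ltW.
- apply: derivable_within_continuous => z /ys /sr bz.
  have /is_derive_partial2[dz _] : Omega (x, z) by apply: pO'.
  exact: derivableZ.
- by rewrite ge_min (ltW fn) le_max (ltW fp) orbT.
exists z; split; first exact: sr.
  by rewrite -ball_normE /= distrC (le_lt_trans zs).
have c0 : c != 0.
  have [_] := pO (x0, y0) (conj bx0 by0).
  by apply: contraTneq => ->; rewrite mul0r ltxx.
by apply/eqP; move/eqP: cf0; rewrite mulf_eq0 (negbTE c0).
Unshelve. all: by end_near. Qed.

(** Uniqueness of the zero over each abscissa is strict monotonicity of [f] in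
    the second variable; continuity of the resulting function is
    [near_zero_above] applied at every point of its graph. *)
Lemma implicit_local_graph p : zero_set Omega f p -> partial2 f p <> 0 ->
  local_graph (zero_set Omega f) p.
Proof.
move=> [Op fp] /eqP c0.
have : \forall q \near p, Omega q /\ 0 < partial2 f p * partial2 f q.
  near=> q; split; near: q; first exact: open_nbhs_nbhs.
  apply: (cvgr_gt (partial2 f p * partial2 f p)).
    by apply: cvgM; [exact: cvg_cst|exact: continuous_partial2].
  by rewrite -expr2 exprn_even_gt0.
move=> /nbhs_ballP[r /= r0 pO].
have pO' : ball p r `<=` Omega by move=> q /pO[].
have uniq x y y' : ball p r (x, y) -> ball p r (x, y') ->
    f (x, y) = 0 -> f (x, y') = 0 -> y = y'.
  move=> b b' f0 f0'; have [d /pO[_ bd] e] := increment_vertical pO' b b'.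
  move: e; rewrite f0 f0' subrr => /esym/eqP.
  have d0 : partial2 f (x, d) != 0.
    by apply: contraTneq bd => ->; rewrite mulr0 ltxx.
  by rewrite mulf_eq0 (negbTE d0) subr_eq0 => /eqP.
have /nbhs_ballP[d0 /= d00 ex] := near_zero_above pO (ballxx _ r0) fp r0.
pose d := Num.min d0 r.
have dpos : 0 < d by rewrite lt_min d00.
have dr x : ball p.1 d x -> ball p.1 r x.
  by apply: le_ball; rewrite ge_min lexx orbT.
pose g x := xget 0 [set y | ball p.2 r y /\ f (x, y) = 0].
have gP x : ball p.1 d x -> ball p.2 r (g x) /\ f (x, g x) = 0.
  move=> bx; rewrite /g; case: xgetP => [y _ //|nex]; exfalso.
  have /ex[y [b1 _ b2]] : ball p.1 d0 x.
    by apply: le_ball bx; rewrite ge_min lexx.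
  exact: (nex y).
have gE x y : ball p.1 d x -> ball p.2 r y -> f (x, y) = 0 -> y = g x.
  move=> bx byr fy; have [b1 b2] := gP x bx.
  by apply: (uniq x) => //; split => //=; exact: dr.
exists d, r, g; split => //.
- apply/esym/gE; [exact: ballxx|exact: ballxx|].
  by rewrite -surjective_pairing.
- move=> x bx; have [bgx fgx] := gP x bx; split=> //.
  have nbx : \forall t \near x, ball p.1 d t.
    by apply: open_nbhs_nbhs; split=> //; exact: ball_open.
  apply/cvg_ballP => e e0.
  have bxg : ball p r (x, g x) by split => //=; exact: dr.
  apply: filterS2 nbx (near_zero_above pO bxg fgx e0).
  by move=> t bt [y [b1 b2 f0]]; rewrite -(gE t y).
- move=> x y bx byr; split=> [[_ f0]|->]; first exact: gE.
  have [bgx fgx] := gP x bx; split=> //; apply: pO'.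
  by split => //=; exact: dr.
Unshelve. all: by end_near. Qed.

(** Going from (x, h x) to (y, h y) through the corner (x, h y), the mean value
    theorem on each leg gives
    [0 = partial1 f (c, h y) * (y - x) + partial2 f (x, d) * (h y - h x)]
    with intermediate points that tend to (x, h x). *)
Lemma implicit_derive (h : R -> R) x : Omega (x, h x) ->
  partial2 f (x, h x) <> 0 -> {for x, continuous h} ->
  (\forall t \near x, f (t, h t) = 0) ->
  is_derive x 1 h (- (partial1 f (x, h x) / partial2 f (x, h x))).
Proof.
set p := (x, h x) => Op /eqP p0 ch fh.
set L := - _.
suff dh : (fun t => t^-1 *: (h (t *: (1 : R) + x) - h x)) @ 0^' --> L.
  by apply: DeriveDef; [exact: cvgP dh|exact: cvg_lim dh].
have cQ : (fun q : (R * R) * (R * R) => - (partial1 f q.1 / partial2 f q.2)) q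
    @[q --> (p, p)] --> L.
  apply: cvgN; apply: cvgM.
    by apply: (cvg_comp fst (partial1 f));
      [exact: cvg_fst|exact: continuous_partial1].
  apply: cvgV => //.
  by apply: (cvg_comp snd (partial2 f));
    [exact: cvg_snd|exact: continuous_partial2].
have sh : (fun t : R => t *: (1 : R) + x) t @[t --> 0^'] --> x.
  have : (fun t : R => t *: (1 : R) + x) t @[t --> (0 : R)] -->
      (0 : R) *: (1 : R) + x.
    apply: cvgD; last exact: cvg_cst.
    by apply: cvgZl; exact: cvg_id.
  rewrite scale0r add0r; apply: cvg_trans; apply: cvg_app; exact: nbhs_dnbhs.
have nO : \forall q \near p, Omega q /\ partial2 f q != 0.
  near=> q; split; near: q; first exact: open_nbhs_nbhs.
  exact: cvgr_neq0 (continuous_partial2 Op) p0.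
apply/cvgrPdist_lt => e e0.
have /cvgrPdist_lt/(_ _ e0)/nbhs_ballP[r /= r0 rQ] := cQ.
have rQ' q1 q2 : ball p r q1 -> ball p r q2 ->
    `|L - - (partial1 f q1 / partial2 f q2)| < e.
  by move=> b1 b2; exact: (rQ (q1, q2) (conj b1 b2)).
have /nbhs_ballP[r' /= r'0 rO] := nO.
pose s := Num.min r r'.
have s0 : 0 < s by rewrite lt_min r0.
have bsr q : ball p s q -> ball p r q by apply: le_ball; rewrite ge_min lexx.
have bsr' q : ball p s q -> ball p r' q.
  by apply: le_ball; rewrite ge_min lexx orbT.
have pO : ball p s `<=` Omega by move=> q /bsr'/rO[].
have fx : f p = 0 by exact: nbhs_singleton fh.
have nx : \forall t \near x,
    [/\ f (t, h t) = 0, ball x s t & ball (h x) s (h t)].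
  near=> t; split; near: t => //; first exact: nbhsx_ballx.
  by apply: ch; exact: nbhsx_ballx.
near=> t.
have t0 : t != 0 by near: t; exact: nbhs_dnbhs_neq.
have [ft bt bht] : [/\ f (t *: 1 + x, h (t *: 1 + x)) = 0,
    ball x s (t *: 1 + x) & ball (h x) s (h (t *: 1 + x))].
  by near: t; apply: (sh _ nx).
set y := t *: 1 + x in ft bt bht *.
have b1 : ball p s (y, h y) by [].
have b2 : ball p s (x, h y) by split => //=; exact: ballxx.
have b3 : ball p s (x, h x) by exact: ballxx.
have [c bc ec] := increment_horizontal pO b1 b2.
have [d bd ed] := increment_vertical pO b2 b3.
have [_ d0] := rO _ (bsr' _ bd).
have -> : t^-1 *: (h y - h x) = - (partial1 f (c, h y) / partial2 f (x, d)).
  have yx : y - x = t by rewrite /y /GRing.scale /= mulr1 addrK.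
  move: ec ed; rewrite ft fx yx.
  set A := partial1 _ _; set B := partial2 _ _ in d0 *.
  rewrite /GRing.scale /=.
  set u := f (x, h y) => ec ed.
  have hd : h y - h x = - (A * t) / B.
    apply: (mulfI d0); rewrite -ed mulrCA divff// mulr1 -ec.
    by rewrite sub0r opprK subr0.
  by rewrite hd; field; rewrite d0 t0.
exact: (rQ' _ _ (bsr _ bc) (bsr _ bd)).
Unshelve. all: by end_near. Qed.

End ImplicitFunction.

(** * From symmetric data to an involution *)

Section SymmetricData.
Variable R : realType.
Variables (Omega : set (R * R)) (f : R * R -> R).
Hypothesis data : symmetric_C1_data Omega f.
Let Gamma := zero_component Omega f.
Let oO : open Omega := data_open data.
Let C1f : C1_on2 Omega f := data_C1 data.

(** The reflection in the diagonal maps the zero set to itself and fixes the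
    origin, so it maps the component of the origin to a connected subset of
    the zero set through the origin. *)
Lemma zero_component_swap x y : Gamma (x, y) -> Gamma (y, x).
Proof.
move=> Gxy; pose swap (p : R * R) := (p.2, p.1).
have sub : swap @` Gamma `<=` Gamma.
  apply: connected_component_max.
  - exists (0, 0) => //; apply: connected_component_refl.
    by split; [exact: data_origin data|exact: data_f0 data].
  - move=> _ [[a b] /connected_component_sub[/= Oab fab] <-].
    by have [Oba fba] := data_sym data Oab; split => //; rewrite /swap /= fba.
  - apply: connected_continuous_connected; first exact: component_connected.
    apply: continuous_subspaceT => -[a b].
    by apply: (@cvg_pair _ _ _ (nbhs (a, b)) (nbhs b) (nbhs a));
      [exact: cvg_snd|exact: cvg_fst].
by apply: sub; exists (x, y).
Qed.

Lemma partial1_partial2_origin : partial1 f (0, 0) = partial2 f (0, 0).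
Proof.
rewrite partial1_slice partial2_slice; apply: near_eq_derive.
have : \forall p \near (0 : R, 0 : R), Omega p.
  by apply: open_nbhs_nbhs; split => //; exact: data_origin data.
move=> /nbhs_ballP[r /= r0 rO]; near=> t.
have Ot : Omega (0, t).
  apply: rO; split => /=; first exact: ballxx.
  by near: t; exact: nbhsx_ballx.
by have [] := data_sym data Ot.
Unshelve. all: by end_near. Qed.

(** The component is the graph of a function [h] by [component_graph], of
    class C1 by the implicit differentiation formula, and the symmetry of the
    component says that [h] is its own inverse. Since the two partial
    derivatives agree at the origin, [h] has derivative -1 there, which
    excludes the identity. *)
Lemma zero_component_involution : exists (J : set R) (h : R -> R),
  [/\ open_interval J, smooth_involution_on J h & Gamma = graph_on J h].
Proof.
have Z0 : zero_set Omega f (0, 0).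
  by split; [exact: data_origin data|exact: data_f0 data].
have [J [h [[oJ iJ] J0 h0 ch GJ]]] : exists (J : set R) (h : R -> R),
    [/\ open_interval J, J 0, h 0 = 0, forall x, J x -> {for x, continuous h} &
        Gamma = graph_on J h].
  apply: component_graph => // p Gp; apply: implicit_local_graph => //.
    exact: connected_component_sub Gp.
  exact: data_partial2 data _ Gp.
have Gh x : J x -> Gamma (x, h x) by move=> Jx; rewrite GJ; split.
have Jh x : J x -> J (h x) /\ h (h x) = x.
  by move=> /Gh/zero_component_swap; rewrite GJ => -[/= Jhx <-].
have nearJ x : J x -> \forall t \near x, J t.
  by move=> Jx; exact: open_nbhs_nbhs.
have Oh x : J x -> Omega (x, h x) by move=> /Gh/connected_component_sub[].
have dh x : J x ->
    is_derive x 1 h (- (partial1 f (x, h x) / partial2 f (x, h x))).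
  move=> Jx; apply: (@implicit_derive R Omega f) => //.
  - exact: Oh.
  - exact: data_partial2 data _ (Gh _ Jx).
  - exact: ch.
  - by apply: filterS (nearJ _ Jx) => t /Gh/connected_component_sub[].
exists J, h; split => //; split.
- split => //.
  + by rewrite continuous_open_subspace// => x /set_mem; exact: ch.
  + apply/seteqP; split=> [_ [x Jx <-]|x Jx]; first by have [] := Jh x Jx.
    by exists (h x); have [] := Jh x Jx.
  + by move=> x /Jh[].
  + apply: contrapT => nex.
    have hid x : J x -> h x = x.
      by move=> Jx; apply: contrapT => hx; apply: nex; exists x.
    have := @derive_val _ _ _ _ _ _ _ (dh _ J0).
    have -> : 'D_1 h 0 = 'D_(1 : R) (@id R) 0.
      by apply: near_eq_derive; apply: filterS (nearJ _ J0) => t /hid.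
    have /eqP p0 : partial2 f (0, 0) <> 0.
      by apply: (data_partial2 data); exact: connected_component_refl.
    rewrite derive_id h0 partial1_partial2_origin divff// => /eqP.
    by rewrite -subr_eq0 opprK -mulr2n pnatr_eq0.
- split=> [x /dh[]//|].
  rewrite continuous_open_subspace// => x /set_mem Jx.
  apply: (@continuous_near_eq _ _
    (fun t => - (partial1 f (t, h t) / partial2 f (t, h t)))).
    by apply: filterS (nearJ _ Jx) => t /dh[_ <-]; rewrite derive1E.
  have cpair : (t, h t) @[t --> x] --> (x, h x).
    by apply: (@cvg_pair _ _ _ (nbhs x) (nbhs x) (nbhs (h x)));
      [exact: cvg_id|exact: ch].
  have /eqP p0 : partial2 f (x, h x) <> 0.
    exact: data_partial2 data _ (Gh _ Jx).
  apply: cvgN; apply: cvgM.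
    apply: (cvg_comp _ (partial1 f) cpair).
    exact: continuous_partial1 oO C1f _ (Oh _ Jx).
  apply: cvgV => //; apply: (cvg_comp _ (partial2 f) cpair).
  exact: continuous_partial2 oO C1f _ (Oh _ Jx).
Qed.

End SymmetricData.

(** * From an involution to symmetric data *)

Section Involution.
Variable R : realType.
Variables (J : set R) (h : R -> R).
Hypotheses (oiJ : open_interval J) (hJ : smooth_involution_on J h).
Let oJ : open J := oiJ.1.

Lemma involution_stable x : J x -> J (h x).
Proof.
move=> Jx; have [[_ onto _ _ _ _] _] := hJ.
by rewrite -onto; exists x.
Qed.

(** A continuous injection of an interval is monotone, and a point [x] with
    [h x <> x] shows that it is not increasing, since [h] exchanges [x] and
    [h x]. *)
Lemma involution_decreasing : {in J &, {mono h : x y /~ x <= y}}.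
Proof.
have [[ch onto inv J0 h0 [x Jx hx]] _] := hJ.
have /is_intervalP JE := oiJ.2.
have memJ t : (t \in Rhull J) = (t \in J).
  by rewrite [in RHS]JE; apply/idP/idP => [?|/set_mem//]; exact/mem_set.
have inj : {in Rhull J &, injective h}.
  move=> s t; rewrite !memJ => /set_mem Js /set_mem Jt st.
  by rewrite -(inv s)// st inv.
have ex : exists a b, [/\ a \in Rhull J, b \in Rhull J, a < b & h b <= h a].
  have Jhx := involution_stable Jx.
  have [hxx|xhx] := ltP (h x) x.
    by exists (h x), x; rewrite !memJ !mem_set// inv//; split=> //; exact: ltW.
  exists x, (h x); rewrite !memJ !mem_set// inv//; split=> //.
  by rewrite lt_neqAle xhx andbT eq_sym; exact/eqP.
move=> s1 s2; rewrite -!memJ.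
by apply: (itv_continuous_inj_ge ex) => //; rewrite -JE.
Qed.

Lemma involution_derive_le0 x : J x -> derive1 h x <= 0.
Proof.
have [_ [dh _]] := hJ; have JJ : J° = J by apply/interior_id.
move=> Jx; apply: (@decr_derive1_le0 R h J x); rewrite ?JJ//.
  by move=> y /set_mem; exact: dh.
move=> y z Jy Jz yz.
by rewrite ltNge involution_decreasing// -ltNge.
Qed.

(** Symmetric, and zero at (x, h x) because h (h x) = x; the minus signs make
    both partial derivatives positive for a decreasing [h]. *)
Definition defect (p : R * R) : R := p.1 + p.2 - h p.1 - h p.2.

Let Omega : set (R * R) := J `*` J.

Lemma is_derive_defect (c x : R) : J x ->
  is_derive x 1 (fun s => c + (s - h s)) (1 - derive1 h x).
Proof.
have [_ [dh _]] := hJ; move=> /dh dhx.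
have hd : is_derive x 1 h (derive1 h x).
  by apply: DeriveDef => //; rewrite derive1E.
by apply: is_derive_eq; rewrite add0r mul1r.
Qed.

Lemma partial1_defect p : J p.1 ->
  derivable defect p (1, 0) /\ partial1 defect p = 1 - derive1 h p.1.
Proof.
move: p => [x y] /= Jx.
have e : (fun s => defect (s, y)) = (fun s => (y - h y) + (s - h s)).
  by apply/funext => s; rewrite /defect /=; ring.
have [dd dE] := is_derive_defect (y - h y) Jx.
by split; [apply/derivable_slice1|rewrite partial1_slice]; rewrite e.
Qed.

Lemma partial2_defect p : J p.2 ->
  derivable defect p (0, 1) /\ partial2 defect p = 1 - derive1 h p.2.
Proof.
move: p => [x y] /= Jy.
have e : (fun s => defect (x, s)) = (fun s => (x - h x) + (s - h s)).
  by apply/funext => s; rewrite /defect /=; ring.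
have [dd dE] := is_derive_defect (x - h x) Jy.
by split; [apply/derivable_slice2|rewrite partial2_slice]; rewrite e.
Qed.

(** With [k t = t - h t] the equation reads [k y = - k x = k (h x)], and [k] is
    strictly increasing because [h] decreases. *)
Lemma zero_set_defect : zero_set Omega defect = graph_on J h.
Proof.
have [[_ _ inv _ _ _] _] := hJ.
apply/seteqP; split=> [[x y] /= [[/= Jx Jy] d0]|[x y] [/= Jx ->]]; last first.
  split; first by split=> //; exact: involution_stable.
  by rewrite /defect /= inv//; ring.
split => //=; have Jhx := involution_stable Jx.
have hmono := involution_decreasing.
have d1 : y - h y = h x - h (h x) by move: d0; rewrite /defect /= inv//; lra.
have [yx|xy|//] := ltgtP y (h x).
- have : h (h x) <= h y by rewrite hmono ?inE// ltW.
  by lra.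
- have : h y <= h (h x) by rewrite hmono ?inE// ltW.
  by lra.
Qed.

Lemma involution_zero_component : symmetric_C1_data Omega defect /\
  zero_component Omega defect = graph_on J h.
Proof.
have [[ch onto inv J0 h0 _] [dh ch']] := hJ.
have oO : open Omega.
  rewrite openE => p [Jp1 Jp2].
  by exists (J, J) => //; split; exact: open_nbhs_nbhs.
have c' x : J x -> {for x, continuous (derive1 h)}.
  move: ch'; rewrite continuous_open_subspace// => c Jx.
  by apply: c; rewrite inE.
have nearO p : Omega p -> \forall q \near p, Omega q.
  by move=> Op; exact: open_nbhs_nbhs.
have GE : zero_component Omega defect = graph_on J h.
  rewrite /zero_component zero_set_defect; apply: connected_component_id.
    by split=> //=; rewrite h0.
  apply: connected_graph; first exact: oiJ.2.
  move: ch; rewrite continuous_open_subspace// => c x Jx.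
  by apply: c; rewrite inE.
split => //; split=> //.
- split.
  + by move=> p [/partial1_defect[? _] /partial2_defect[? _]].
  + rewrite continuous_open_subspace// => p /set_mem Op.
    apply: (@continuous_near_eq _ _ (fun q => 1 - derive1 h q.1)).
      by apply: filterS (nearO _ Op) => q [/partial1_defect[_ ->]].
    apply: cvgB; first exact: cvg_cst.
    by apply: (cvg_comp fst); [exact: cvg_fst|apply: c'; exact: Op.1].
  + rewrite continuous_open_subspace// => p /set_mem Op.
    apply: (@continuous_near_eq _ _ (fun q => 1 - derive1 h q.2)).
      by apply: filterS (nearO _ Op) => q [_ /partial2_defect[_ ->]].
    apply: cvgB; first exact: cvg_cst.
    by apply: (cvg_comp snd); [exact: cvg_snd|apply: c'; exact: Op.2].
- by rewrite /defect /= h0; ring.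
- by move=> x y [Jx Jy]; split; [split|rewrite /defect /=; ring].
- rewrite GE => -[x y] [/= Jx ->].
  have [_ ->] := @partial2_defect (x, h x) (involution_stable Jx).
  have /= := involution_derive_le0 (involution_stable Jx).
  by lra.
Qed.

End Involution.

Theorem proposition3p2 (R : realType) :
  (forall (Omega : set (R * R)) (f : R * R -> R),
     symmetric_C1_data Omega f ->
     exists (J : set R) (h : R -> R),
       [/\ open_interval J, smooth_involution_on J h &
           zero_component Omega f = graph_on J h]) /\
  (forall (J : set R) (h : R -> R),
     open_interval J -> smooth_involution_on J h ->
     exists (Omega : set (R * R)) (f : R * R -> R),
       symmetric_C1_data Omega f /\ zero_component Omega f = graph_on J h).
Proof.
split; first by move=> Omega f; exact: zero_component_involution.
move=> J h oiJ hJ.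
by exists (J `*` J), (defect h); exact: involution_zero_component.
Qed.
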